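(* Let $T$ be a regular interval exchange transformation on the alphabet $A$ and let $S=F(T)$. For any finite $S$-maximal bifix code $X$ with coding morphism $f:B^*\to A^*$, the interval exchange transformation $T_f$ is regular.
   Context: $A$ is a finite alphabet with two total orders $<_1,<_2$. Let $(I_a)_{a\in A}$ be a partition of $[0,1[$ into nonempty semi-intervals $[\alpha,\beta[$ ordered for $<_1$ (i.e. $a<_1 b$ implies $I_a$ lies to the left of $I_b$). With $\lambda_a=|I_a|$, $\mu_a=\sum_{b\le_1 a}\lambda_b$, $\nu_a=\sum_{b\le_2 a}\lambda_b$, $\alpha_a=\nu_a-\mu_a$, the interval exchange transformation relative to $(I_a)$ is $T(z)=z+\alpha_a$ for $z\in I_a$ (the same construction applies to any finite alphabet with two total orders and an ordered partition). Writing the alphabet as $\{a_1<_1\cdots<_1 a_s\}$ and $\mu_i=\mu_{a_i}$, the transformation is regular if the orbits $\{T^n(\mu_i)\mid n\in\mathbb{Z}\}$, $1\le i\le s-1$, are infinite and pairwise disjoint; regular transformations are minimal (every orbit is dense). For $w=b_0\cdots b_{m-1}\in A^*$, $I_w=I_{b_0}\cap T^{-1}(I_{b_1})\cap\cdots\cap T^{-m+1}(I_{b_{m-1}})$. The natural coding $\Sigma_T(z)=a_0a_1\cdots$ has $a_n=a$ iff $T^n(z)\in I_a$; for minimal $T$ the set of factors of $\Sigma_T(z)$ is independent of $z$, denoted $F(T)$. A bifix code is a set of nonempty words none of which is a proper prefix or proper suffix of another; a bifix code $X\subset S$ is $S$-maximal if it is not properly contained in a bifix code $Y\subset S$. A coding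 morphism for $X$ is a morphism $f:B^*\to A^*$ mapping the alphabet $B$ bijectively onto $X$. On $A^*$, $<_1$ is the lexicographic order induced by $<_1$, and $u<_2 v$ means $u$ is a proper suffix of $v$ or $u=waz,v=tbz$ with letters $a<_2 b$; $B$ is ordered by $b<_i b'$ iff $f(b)<_i f(b')$. $T_f$ is the interval exchange transformation on $B$ (with these orders) relative to the family $(K_b)_{b\in B}$, $K_b=I_{f(b)}$, which is a partition of $[0,1[$ ordered for $<_1$. *)

(* Defs.v *)
From HB Require Import structures.
From mathcomp Require Import all_boot all_order all_algebra.
From mathcomp Require Import all_classical all_reals all_analysis.

Set Implicit Arguments.
Unset Strict Implicit.
Unset Printing Implicit Defensive.

Import Order.TTheory GRing.Theory Num.Theory.

Local Open Scope classical_set_scope.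
Local Open Scope ring_scope.

(* An alphabet carries two orders at once, so they are plain (strict) relations
   instead of an [orderType] structure. *)
Definition strict_total_order (A : eqType) (lt : rel A) : Prop :=
  [/\ irreflexive lt, transitive lt
    & forall a b : A, a != b -> lt a b || lt b a].

Definition semi_interval (R : realType) (D : set R) : Prop :=
  exists alpha beta : R, D = `[alpha, beta[%classic.

(* The library's [partition] includes nonemptiness of the blocks. *)
Definition ordered_partition (R : realType) (A : finType) (lt1 : rel A)
    (I : A -> set R) : Prop :=
  [/\ partition setT I `[0, 1[%classic,
      forall a : A, semi_interval (I a)
    & forall a b : A, lt1 a b ->
        forall x y : R, I a x -> I b y -> x < y].

Section IntervalExchange.
Context {R : realType} {A : finType}.
Implicit Types (lt : rel A) (I : A -> set R).

Definition ilength I (a : A) : R := fine (lebesgue_measure (I a)).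

Definition cumul (lt : rel A) I (a : A) : R :=
  \sum_(b : A | (b == a) || lt b a) ilength I b.

Definition translation lt1 lt2 I (a : A) : R := cumul lt2 I a - cumul lt1 I a.

(* [iet] is only meaningful on [0, 1[; it is the identity elsewhere. *)
Definition iet lt1 lt2 I (z : R) : R :=
  if [pick a : A | z \in I a] is Some a then z + translation lt1 lt2 I a else z.

Definition iet_inv lt1 lt2 I : R -> R :=
  'pinv_(fun=> 0) `[0, 1[%classic (iet lt1 lt2 I).

Definition iet_iter lt1 lt2 I (n : int) (z : R) : R :=
  match n with
  | Posz k => iter k (iet lt1 lt2 I) z
  | Negz k => iter k.+1 (iet_inv lt1 lt2 I) z
  end.

Definition iet_orbit lt1 lt2 I (z : R) : set R :=
  range (fun n : int => iet_iter lt1 lt2 I n z).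

Definition interval_exchange lt1 lt2 I : Prop :=
  [/\ strict_total_order lt1, strict_total_order lt2
    & ordered_partition lt1 I].

(* The letters a_1, ..., a_(s-1) are those that are not greatest for lt1. *)
Definition not_greatest lt1 : set A := [set a | exists b : A, lt1 a b].

Definition regular_interval_exchange lt1 lt2 I : Prop :=
  [/\ interval_exchange lt1 lt2 I,
      forall a : A, not_greatest lt1 a ->
        infinite_set (iet_orbit lt1 lt2 I (cumul lt1 I a))
    & trivIset (not_greatest lt1)
        (fun a : A => iet_orbit lt1 lt2 I (cumul lt1 I a))].

Definition word_interval lt1 lt2 I (w : seq A) : set R :=
  [set z | (z \in `[0, 1[) /\
     forall (i : nat) (b : A), onth w i = Some b ->
       I b (iter i (iet lt1 lt2 I) z)].

Definition is_natural_coding lt1 lt2 I (z : R) (u : nat -> A) : Prop :=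
  forall (n : nat) (a : A), u n = a <-> I a (iter n (iet lt1 lt2 I) z).

Definition is_factor (w : seq A) (u : nat -> A) : Prop :=
  exists n : nat, w = mkseq (fun i : nat => u (n + i)%N) (size w).

(* F(T). For minimal T the set of factors of the natural coding of z does not
   depend on z in [0, 1[, so it coincides with this union over all z. *)
Definition factor_set lt1 lt2 I : set (seq A) :=
  [set w | exists (z : R) (u : nat -> A),
     [/\ z \in `[0, 1[, is_natural_coding lt1 lt2 I z u & is_factor w u]].

End IntervalExchange.

Definition bifix_code (A : eqType) (X : set (seq A)) : Prop :=
  [/\ forall x : seq A, X x -> x <> [::],
      forall x y : seq A, X x -> X y -> ~ (prefix x y /\ x != y)
    & forall x y : seq A, X x -> X y -> ~ (suffix x y /\ x != y)].

Definition maximal_bifix_code (A : eqType) (S X : set (seq A)) : Prop :=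
  [/\ bifix_code X, X `<=` S
    & forall Y : set (seq A), bifix_code Y -> Y `<=` S -> ~ X `<` Y].

Definition coding_morphism (A B : eqType) (X : set (seq A))
    (f : seq B -> seq A) : Prop :=
  [/\ f [::] = [::], {morph f : u v / u ++ v}
    & set_bij setT X (fun b : B => f [:: b])].

Definition word_lt1 (A : eqType) (lt1 : rel A) : rel (seq A) := fun u v =>
  `[< (prefix u v /\ u != v) \/
      exists (w z t : seq A) (a b : A),
        [/\ u = w ++ a :: z, v = w ++ b :: t & lt1 a b] >].

Definition word_lt2 (A : eqType) (lt2 : rel A) : rel (seq A) := fun u v =>
  `[< (suffix u v /\ u != v) \/
      exists (w z t : seq A) (a b : A),
        [/\ u = w ++ a :: z, v = t ++ b :: z & lt2 a b] >].

Definition coded_lt (A B : Type) (word_lt : rel (seq A))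
    (f : seq B -> seq A) : rel B :=
  fun b b' => word_lt (f [:: b]) (f [:: b']).

Definition coded_family (R : realType) (A B : finType) (lt1 lt2 : rel A)
    (I : A -> set R) (f : seq B -> seq A) : B -> set R :=
  fun b => word_interval lt1 lt2 I (f [:: b]).

(* Main.v *)
Require Import Defs.
From mathcomp Require Import all_boot all_order all_algebra.
From mathcomp Require Import all_classical all_reals all_analysis.
From mathcomp Require Import lra.

(* With u = f(b), the map T_f is T^|u| on K_b = I_u, because the sets T^|u|(I_u)
   are ordered by <_2 just as the sets I_u are by <_1.

   The K_b cover [0, 1[: otherwise neither they nor the sets J_b = T^|u|(I_u)
   cover, since |J_b| = |K_b|, and a Poincare recurrence argument gives a point
   z outside all K_b with T^n z outside all J_b for some large n; the word of
   length n read from z then enlarges the bifix code X inside F(T).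

   A separation point delta of T_f lying in K_c satisfies T^k delta = mu for a
   separation point mu of T and some k < |f(c)|, whereas a positive iterate of
   T_f at delta is T^N delta with N >= |f(c)| > k.  Hence a connection between
   separation points of T_f yields a forward connection between separation
   points of T, contradicting regularity. *)

Set Implicit Arguments.
Unset Strict Implicit.
Unset Printing Implicit Defensive.

Import Order.TTheory GRing.Theory Num.Theory.

Local Open Scope classical_set_scope.
Local Open Scope ring_scope.

Local Notation mble := (@measurable _ (measurableTypeR _)).

(** * Lebesgue measure restricted to the unit interval *)

Section Volume.
Context {R : realType}.
Implicit Types (E F : set R) (a b t : R).

Definition unit_itv : set R := `[0, 1[%classic.

(** Cutting with [0, 1[ keeps the measure finite, so volumes are compared in [R] and sets matter
    only inside the unit interval. *)
Definition vol E : R := fine (lebesgue_measure (E `&` unit_itv)).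

Lemma unit_itvE x : unit_itv x = (0 <= x < 1) :> Prop.
Proof. by rewrite /unit_itv /= in_itv. Qed.

Lemma mble_unit_itv : mble unit_itv.
Proof. exact: measurable_itv. Qed.

Lemma vol_fin_num E : mble E -> lebesgue_measure (E `&` unit_itv) \is a fin_num.
Proof.
move=> mE; rewrite ge0_fin_numE ?measure_ge0 //.
apply: (@le_lt_trans _ _ (lebesgue_measure unit_itv)).
  by apply: le_measure; rewrite ?inE //; try apply: measurableI => //;
    exact: mble_unit_itv.
by rewrite /unit_itv lebesgue_measure_itv /= lte_fin ltr01 -EFinB ltry.
Qed.

Lemma le_vol E F : mble E -> mble F ->
  (forall x, unit_itv x -> E x -> F x) -> vol E <= vol F.
Proof.
move=> mE mF EF; apply: fine_le; rewrite ?vol_fin_num //.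
apply: le_measure; rewrite ?inE; try by apply: measurableI => //;
  exact: mble_unit_itv.
by move=> x [Ex Dx]; split => //; apply: EF.
Qed.

Lemma eq_vol E F : (forall x, unit_itv x -> E x <-> F x) -> vol E = vol F.
Proof.
move=> EF; rewrite /vol; congr (fine (lebesgue_measure _)).
by apply/seteqP; split=> x [Hx Dx]; split => //; apply/(EF _ Dx).
Qed.

Lemma vol_itv a b : 0 <= a -> a <= b -> b <= 1 -> vol `[a, b[ = b - a.
Proof.
move=> a0 ab b1; rewrite /vol (_ : _ `&` _ = `[a, b[%classic).
  rewrite lebesgue_measure_itv /= lte_fin.
  by case: ltP => // ba; rewrite /=; lra.
apply/seteqP; split => [x [] //|x xab]; split => //.
by rewrite unit_itvE; move: xab; rewrite /= in_itv /= => /andP[]; lra.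
Qed.

Lemma vol_setT : vol setT = 1.
Proof.
rewrite (@eq_vol _ `[0, 1[%classic) => [|x]; last by rewrite unit_itvE /= in_itv.
by rewrite vol_itv // subr0.
Qed.

Lemma vol_bigcup (T : finType) (P : {pred T}) (F : T -> set R) :
  (forall i, mble (F i)) -> trivIset setT F ->
  vol (\bigcup_(i in [set` P]) F i) = \sum_(i in P) vol (F i).
Proof.
move=> mF tF; rewrite /vol setI_bigcupl measure_fin_bigcup //.
- rewrite sum_fine => [|i _]; last exact: vol_fin_num.
  congr (fine _); rewrite -(@bigfs _ _ _ _ (index_enum T) P) ?index_enum_uniq //.
  by move=> i _; rewrite mem_index_enum.
- by move=> i j _ _ [x [[Fi _] [Fj _]]]; apply: tF => //; exists x.
- by move=> t _; apply: measurableI => //; exact: mble_unit_itv.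
Qed.

Lemma mble_translate E t : mble E -> mble [set x | E (x + t)].
Proof.
move=> mE; rewrite -[X in mble X]setTI.
suff: measurable_fun setT ((fun x => x + t) : measurableTypeR R -> measurableTypeR R).
  by apply.
exact: measurable_realfun.measurable_funD.
Qed.

(** The pushforward of Lebesgue measure by a translation agrees with it on bounded half-open
    intervals, and these determine it. *)
Lemma lebesgue_translate E t : mble E ->
  lebesgue_measure [set x | E (x + t)] = lebesgue_measure E.
Proof.
move=> mE.
transitivity (pushforward lebesgue_measure
  ((fun x => x + t) : measurableTypeR R -> measurableTypeR R) E) => //.
apply/esym/lebesgue_measure_unique => //=.
  exact: measurable_realfun.measurable_funD.
move=> _ _ [[a b]] _ <-; rewrite /pushforward.
rewrite [X in _ = _ X](_ : _ = `](a - t), (b - t)]%classic).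
  rewrite !lebesgue_measure_itv /= !lte_fin ltrD2r -!EFinB.
  by case: ifP => // _; congr EFin; lra.
by apply/seteqP; split => x /=; rewrite !in_itv /= lerBrDr ltrBlDr.
Qed.

Lemma vol_translate E t : mble E ->
  (forall x, E x -> unit_itv x) ->
  (forall x, E (x + t) -> unit_itv x) ->
  vol [set x | E (x + t)] = vol E.
Proof.
move=> mE ED EtD; rewrite /vol; congr fine.
rewrite (_ : E `&` _ = E); last by apply/setIidPl.
rewrite (_ : _ `&` _ = [set x | E (x + t)]); last exact/setIidPl.
exact: lebesgue_translate.
Qed.

Lemma volID E F : mble E -> mble F -> vol E = vol (E `&` F) + vol (E `\` F).
Proof.
move=> mE mF; rewrite /vol -fineD; last 2 first.
- by apply: vol_fin_num; apply: measurableI.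
- by apply: vol_fin_num; apply: measurableD.
congr fine; rewrite -measureU.
- by rewrite -setIUl setUIDK.
- by apply: measurableI; [exact: measurableI|exact: mble_unit_itv].
- by apply: measurableI; [exact: measurableD|exact: mble_unit_itv].
- by apply/seteqP; split => x //= [[[_ ?] _] [[_ ?] _]].
Qed.

Lemma vol_ge0 E : 0 <= vol E.
Proof. by rewrite fine_ge0 // measure_ge0. Qed.
End Volume.

(** * Tilings of the unit interval *)

Section Tilings.
Context {R : realType} {B : finType}.
Implicit Types (al be : B -> R) (lt : rel B).

Lemma vol_partition (F : B -> set R) (E : set R) :
  (forall i, mble (F i)) -> trivIset setT F ->
  (forall x, unit_itv x -> exists i, F i x) -> mble E ->
  vol E = \sum_i vol (E `&` F i).
Proof.
move=> mF tF cF mE; rewrite -[RHS](@vol_bigcup _ _ predT).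
- apply: eq_vol => x Dx; split=> [Ex|[i _ [Ex _]] //].
  by have [i Fix] := cF x Dx; exists i.
- by move=> i; apply: measurableI.
- by move=> i j _ _ [x [[_ Fi] [_ Fj]]]; apply: tF => //; exists x.
Qed.

Lemma gap_above (x : R) (g : B -> R) : x < 1 ->
  exists2 m, x < m <= 1 & forall b, x < g b -> m <= g b.
Proof.
(* The default 1 of the minimum covers the case where no [g b] exceeds [x]. *)
move=> x1; exists (\big[Order.min/1]_(b | x < g b) g b).
  apply/andP; split; last exact: bigmin_le_id.
  by apply/bigmin_gtP; split.
by move=> b xb; apply: bigmin_le_cond.
Qed.

(** An uncovered [z] leaves uncovered the whole gap up to some [m] lying below every later left end.
    The intervals left of [z] fit in [0, z[ and the others in [m, 1[, so the lengths add up to at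
    most z + 1 - m < 1. *)
Lemma tiling_cover al be :
  (forall b, [/\ 0 <= al b, al b <= be b & be b <= 1]) ->
  trivIset setT (fun b => `[al b, be b[%classic) ->
  1 <= \sum_b (be b - al b) ->
  forall z, unit_itv z -> exists b, al b <= z < be b.
Proof.
move=> alb tI sum1 z; rewrite unit_itvE => /andP[z0 z1].
apply: contrapT => nz.
have [m /andP[zm m1] mP] := gap_above al z1.
have mI b : mble (`[al b, be b[%classic : set R) by exact: measurable_itv.
have out b : be b <= z \/ m <= al b.
  case: (leP (be b) z) => [|zb]; [by left|right].
  by apply: mP; rewrite ltNge; apply/negP => bz; apply: nz; exists b; rewrite bz.
have volE b : vol `[al b, be b[ = be b - al b.
  by have [? ? ?] := alb b; exact: vol_itv.
move: sum1; rewrite (bigID (fun b => be b <= z)) /= leNgt => /negP; apply.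
have le1 : \sum_(b | be b <= z) (be b - al b) <= z.
  rewrite -(eq_bigr _ (fun b _ => volE b)).
  rewrite -(@vol_bigcup _ _ [pred b | be b <= z]) //.
  rewrite -[leRHS]subr0 -(@vol_itv _ 0 z) //; last exact: ltW.
  apply: le_vol.
  - by apply: fin_bigcup_measurable => // b _; exact: mI.
  - exact: measurable_itv.
  - move=> x _ [b]; rewrite /= inE => bz; rewrite !in_itv /= => /andP[ax xb].
    by have [? _ _] := alb b; lra.
have le2 : \sum_(b | ~~ (be b <= z)) (be b - al b) <= 1 - m.
  rewrite -(eq_bigr _ (fun b _ => volE b)).
  rewrite -(@vol_bigcup _ _ [pred b | ~~ (be b <= z)]) //.
  rewrite -(@vol_itv _ m 1) //; [|by lra]; apply: le_vol.
  - by apply: fin_bigcup_measurable => // b _; exact: mI.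
  - exact: measurable_itv.
  - move=> x _ [b]; rewrite /= inE => bz; rewrite !in_itv /= => /andP[ax xb].
    by move: bz; rewrite -ltNge => bz; have [? ? ?] := alb b; case: (out b) => ?; lra.
by lra.
Qed.

Lemma tiling_trivIset lt al be : strict_total_order lt ->
  (forall b c, lt b c -> be b <= al c) ->
  trivIset setT (fun b => `[al b, be b[%classic).
Proof.
move=> [irr _ tot] ltP b c _ _ [x []]; rewrite /= !in_itv /= => /andP[? ?] /andP[? ?].
by apply/eqP; apply: contraT => /tot/orP[/ltP|/ltP] ?; lra.
Qed.

(** The intervals up to [b] fit in [0, be b[ and the later ones in [be b, 1[; since the total is 1,
    both bounds are attained. This is what identifies [cumul] with a right end. *)
Lemma tiling_right_end lt al be : strict_total_order lt ->
  (forall b, [/\ 0 <= al b, al b < be b & be b <= 1]) ->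
  (forall b c, lt b c -> be b <= al c) ->
  \sum_b (be b - al b) = 1 ->
  forall b, \sum_(c | (c == b) || lt c b) (be c - al c) = be b.
Proof.
move=> slt alb ltP sum1 b.
have tI := tiling_trivIset slt ltP; have [irr tr tot] := slt.
have mI c : mble (`[al c, be c[%classic : set R) by exact: measurable_itv.
have volE c : vol `[al c, be c[ = be c - al c.
  by have [? /ltW ? ?] := alb c; exact: vol_itv.
have [ab0 abb bb1] := alb b.
pose P := [pred c | (c == b) || lt c b].
have le1 : \sum_(c | P c) (be c - al c) <= be b.
  rewrite -(eq_bigr _ (fun b _ => volE b)) -(@vol_bigcup _ _ P) //.
  rewrite -[leRHS]subr0 -(@vol_itv _ 0 (be b)) //; last by lra.
  apply: le_vol.
  - by apply: fin_bigcup_measurable => // c _; exact: mI.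
  - exact: measurable_itv.
  - move=> x _ [c]; rewrite /= inE /= => cb; rewrite !in_itv /= => /andP[ax xb].
    have [? _ _] := alb c; case/orP: cb => [/eqP <-|/ltP ?]; lra.
have le2 : \sum_(c | ~~ P c) (be c - al c) <= 1 - be b.
  rewrite -(eq_bigr _ (fun b _ => volE b)) -(@vol_bigcup _ _ [predC P]) //.
  rewrite -(@vol_itv _ (be b) 1) //; last by lra.
  apply: le_vol.
  - by apply: fin_bigcup_measurable => // c _; exact: mI.
  - exact: measurable_itv.
  - move=> x _ [c]; rewrite /= inE /= => cb; rewrite !in_itv /= => /andP[ax xb].
    have [? ? ?] := alb c; move: cb; rewrite negb_or => /andP[cb ncb].
    by have := tot _ _ cb; rewrite (negbTE ncb) => /ltP ?; lra.
move: sum1; rewrite (bigID P) /=; rewrite /= in le1 le2.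
by lra.
Qed.
End Tilings.

(** * Endpoints of ordered families of intervals *)

Section OrderedFamilies.
Context {R : realType} {A : finType}.
Implicit Types (lt : rel A) (I : A -> set R).

Lemma itv_sub_unit (a b : R) : a < b ->
  (forall x, a <= x < b -> unit_itv x) -> 0 <= a /\ b <= 1.
Proof.
move=> ab sub; have : unit_itv a by apply: sub; lra.
rewrite unit_itvE => /andP[a0 a1]; split => //.
rewrite leNgt; apply/negP => b1.
have : unit_itv (1 : R) by apply: sub; lra.
by rewrite unit_itvE; lra.
Qed.

Lemma itv_separated (a b c d : R) : a < b -> c < d ->
  (forall x y, a <= x < b -> c <= y < d -> x < y) -> b <= c.
Proof.
move=> ab cd sep; rewrite leNgt; apply/negP => cb.
have := sep (Order.max a c) c; rewrite le_max lexx gt_max ab cb lexx cd.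
by move=> /(_ isT isT); rewrite ltNge le_max lexx orbT.
Qed.

Lemma semi_interval_ends (J : set R) : semi_interval J -> J !=set0 ->
  J `<=` unit_itv ->
  exists p : R * R, [/\ J = `[p.1, p.2[%classic, 0 <= p.1, p.1 < p.2 & p.2 <= 1].
Proof.
move=> [a [b ->]] [x xI] sub; move: xI; rewrite /= in_itv /= => /andP[ax xb].
have ab : a < b by lra.
have [|a0 b1] := @itv_sub_unit a b ab; last by exists (a, b).
by move=> y ayb; apply: sub; rewrite /= in_itv.
Qed.

(** The letters up to [a] all lie strictly below [b], so after removing the term of [b] the two sums
    compare termwise. *)
Lemma le_cumul lt I a b : strict_total_order lt ->
  (forall c, 0 <= ilength I c) -> lt a b ->
  cumul lt I a + ilength I b <= cumul lt I b.
Proof.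
move=> [irr tr _] I0 ab.
rewrite /cumul [leRHS](bigD1 b) ?eqxx //= [leRHS]addrC lerD2r [leRHS]big_mkcond /=.
rewrite [leLHS]big_mkcond; apply: ler_sum => c _.
case: ifP => [/orP[/eqP ->|ca]|_].
- by rewrite ab orbT; case: eqP => //= ab'; move: ab; rewrite ab' irr.
- rewrite (tr _ _ _ ca ab) orbT /=; case: eqP => //= cb.
  by have := tr _ _ _ ab; rewrite -cb => /(_ _ ca); rewrite irr.
- by case: ifP.
Qed.

Lemma cumul_inj lt I : strict_total_order lt ->
  (forall c, 0 < ilength I c) -> injective (cumul lt I).
Proof.
move=> slt I0 a b eqc; apply/eqP; apply: contraT => ab.
have I0' c : 0 <= ilength I c by exact: ltW.
have [_ _ tot] := slt; have := (I0 a, I0 b).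
by case/orP: (tot _ _ ab) => /(le_cumul slt I0'); rewrite eqc => ? []; lra.
Qed.

Lemma cumul_ge lt I a : (forall c, 0 <= ilength I c) ->
  ilength I a <= cumul lt I a.
Proof.
move=> I0; rewrite /cumul (bigD1 a) ?eqxx //= lerDl.
by apply: sumr_ge0.
Qed.

Lemma cumul_le lt I a : (forall c, 0 <= ilength I c) ->
  cumul lt I a <= \sum_c ilength I c.
Proof.
by move=> I0; rewrite /cumul big_mkcond; apply: ler_sum => c _; case: ifP.
Qed.

(** The ends supplied by [semi_interval] carry no formula; [tiling_right_end] expresses them by
    cumulated lengths, so that membership in [I a] becomes a linear inequality. *)
Lemma ordered_partition_ends lt I : strict_total_order lt ->
  ordered_partition lt I ->
  [/\ forall a, 0 < ilength I a, \sum_a ilength I a = 1 &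
      forall a, I a = `[cumul lt I a - ilength I a, cumul lt I a[%classic].
Proof.
move=> slt [[cI tI nI] sI oI].
have subI a : I a `<=` unit_itv.
  by move=> x Ix; rewrite /unit_itv -cI; exists a.
have /choice[p pP] : forall a, exists p : R * R,
    [/\ I a = `[p.1, p.2[%classic, 0 <= p.1, p.1 < p.2 & p.2 <= 1].
  by move=> a; apply: semi_interval_ends => //; exact: nI.
pose al a := (p a).1; pose be a := (p a).2.
have IE a : I a = `[al a, be a[%classic by case: (pP a).
have ab a : [/\ 0 <= al a, al a < be a & be a <= 1] by case: (pP a).
have lenE a : ilength I a = be a - al a.
  by rewrite /ilength IE lebesgue_measure_itv /= lte_fin; have [_ -> _] := ab a.
have sum1 : \sum_a (be a - al a) = 1.
  rewrite -(@vol_setT R) (@vol_partition _ _ I setT) //.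
  - apply: eq_bigr => a _; rewrite setTI IE vol_itv //; by have [? /ltW] := ab a.
  - by move=> a; rewrite IE; exact: measurable_itv.
  - by move=> x Dx; move: (Dx); rewrite /unit_itv -cI => -[a _ Iax]; exists a.
have ltP a b : lt a b -> be a <= al b.
  move=> lab; have [_ la _] := ab a; have [_ lb _] := ab b.
  apply: (itv_separated la lb) => x y xa yb.
  by apply: (oI _ _ lab); rewrite IE /= in_itv.
split=> [a||a].
- by rewrite lenE; have [? ? ?] := ab a; lra.
- by rewrite -sum1; apply: eq_bigr.
- rewrite IE.
  have -> : cumul lt I a = be a.
    by rewrite -(tiling_right_end slt ab ltP sum1 a); apply: eq_bigr.
  by rewrite lenE (_ : be a - _ = al a) //; lra.
Qed.
End OrderedFamilies.

(** * Bijectivity, invariant measure and orbits of an interval exchange *)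

Section IntervalExchangeMap.
Context {R : realType} {A : finType} (lt1 lt2 : rel A) (I : A -> set R)
  (hI : interval_exchange lt1 lt2 I).
Implicit Types (a b : A) (x y z : R).

Local Notation T := (iet lt1 lt2 I).
Local Notation tau := (translation lt1 lt2 I).
Local Notation len := (ilength I).

Let slt1 : strict_total_order lt1. Proof. by case: hI. Qed.
Let slt2 : strict_total_order lt2. Proof. by case: hI. Qed.
Let opI : ordered_partition lt1 I. Proof. by case: hI. Qed.

Lemma ilength_gt0 a : 0 < len a.
Proof. by case: (ordered_partition_ends slt1 opI). Qed.

Lemma sum_ilength : \sum_a len a = 1.
Proof. by case: (ordered_partition_ends slt1 opI). Qed.

Lemma letter_itv a : I a = `[cumul lt1 I a - len a, cumul lt1 I a[%classic.
Proof. by case: (ordered_partition_ends slt1 opI). Qed.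

Lemma letter_itvE a x :
  I a x = (cumul lt1 I a - len a <= x < cumul lt1 I a) :> Prop.
Proof. by rewrite letter_itv /= in_itv. Qed.

Lemma letter_exists x : unit_itv x -> exists a, I a x.
Proof.
by have [[cI _ _] _ _] := opI; rewrite /unit_itv -cI => -[a _ Ia]; exists a.
Qed.

Lemma letter_unique a b x : I a x -> I b x -> a = b.
Proof. by have [[_ tI _] _ _] := opI => Ia Ib; apply: tI => //; exists x. Qed.

Lemma letter_unit a x : I a x -> unit_itv x.
Proof. by have [[cI _ _] _ _] := opI; rewrite /unit_itv -cI; exists a. Qed.

Lemma ietE a x : I a x -> T x = x + tau a.
Proof.
move=> Iax; rewrite /iet; case: pickP => [b /set_mem Ibx|/(_ a)].
  by rewrite (letter_unique Iax Ibx).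
by rewrite mem_set.
Qed.

Let len_ge0 a : 0 <= len a. Proof. exact: ltW (ilength_gt0 a). Qed.

(** The translation by nu_a - mu_a moves the right end mu_a of [I a] to nu_a, so the image of [I a]
    is the block of [a] in the tiling ordered by [lt2]. *)
Lemma iet_letterP a x :
  I a x <-> cumul lt2 I a - len a <= x + tau a < cumul lt2 I a.
Proof. by rewrite letter_itvE /translation; split=> /andP[? ?]; lra. Qed.

Lemma iet_lt2 a b x y : lt2 a b -> I a x -> I b y -> T x < T y.
Proof.
move=> ab Iax Iby; rewrite (ietE Iax) (ietE Iby).
move/iet_letterP: Iax; move/iet_letterP: Iby => /andP[? ?] /andP[? ?].
by have := le_cumul slt2 len_ge0 ab; lra.
Qed.

Lemma iet_unit x : unit_itv x -> unit_itv (T x).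
Proof.
move=> /letter_exists[a Iax]; rewrite unit_itvE (ietE Iax).
move/iet_letterP: Iax => /andP[? ?]; have := cumul_ge lt2 a len_ge0.
by have := cumul_le lt2 a len_ge0; rewrite sum_ilength; lra.
Qed.

Lemma iter_iet_unit n x : unit_itv x -> unit_itv (iter n T x).
Proof. by elim: n => //= n IHn Dx; apply: iet_unit; apply: IHn. Qed.

Lemma iet_inj x y : unit_itv x -> unit_itv y -> T x = T y -> x = y.
Proof.
move=> /letter_exists[a Iax] /letter_exists[b Iby] eqT.
have [ab|ab] := eqVneq a b.
  by move: eqT; rewrite (ietE Iax) (ietE Iby) ab; apply: addIr.
have [_ _ tot] := slt2.
case/orP: (tot _ _ ab) => ab'.
  by have := iet_lt2 ab' Iax Iby; rewrite eqT ltxx.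
by have := iet_lt2 ab' Iby Iax; rewrite eqT ltxx.
Qed.

Lemma iter_iet_inj n x y : unit_itv x -> unit_itv y ->
  iter n T x = iter n T y -> x = y.
Proof.
move=> Dx Dy; elim: n => //= n IHn /iet_inj eqT; apply: IHn; apply: eqT;
  exact: iter_iet_unit.
Qed.

(** The images of the letter intervals are disjoint, being ordered by [lt2], and of total length 1,
    so they leave no gap. *)
Lemma iet_surj y : unit_itv y -> exists2 x, unit_itv x & T x = y.
Proof.
move=> Dy.
have [|||a] := @tiling_cover _ _ (fun a => cumul lt2 I a - len a)
  (cumul lt2 I) _ _ _ y Dy.
- move=> a; have := cumul_ge lt2 a len_ge0; have := ilength_gt0 a.
  by have := cumul_le lt2 a len_ge0; rewrite sum_ilength; split; lra.
- apply: (tiling_trivIset slt2) => b c /(le_cumul slt2 len_ge0); lra.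
- rewrite -sum_ilength le_eqVlt; apply/orP; left; apply/eqP.
  by apply: eq_bigr => a _; lra.
move=> ya.
have Ia : I a (y - tau a) by apply/iet_letterP; rewrite subrK.
by exists (y - tau a); [exact: letter_unit Ia|rewrite (ietE Ia) subrK].
Qed.

Lemma mble_letter a : mble (I a).
Proof. by rewrite letter_itv; exact: measurable_itv. Qed.

Lemma mble_preimage_iet E : mble E -> mble [set x | E (T x)].
Proof.
(* [iet] is the identity off [0, 1[, whence the part of [E] outside the unit interval. *)
move=> mE; rewrite (_ : mkset _ = (E `\` unit_itv) `|`
   \bigcup_(a in setT) (I a `&` [set x | E (x + tau a)])).
  apply: measurableU; first exact: measurableD mE mble_unit_itv.
  apply: fin_bigcup_measurable => // a _.
  by apply: measurableI; [exact: mble_letter|exact: mble_translate].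
apply/seteqP; split => x /=.
  have [Dx|nDx] := pselect (unit_itv x).
    have [a Iax] := letter_exists Dx; rewrite (ietE Iax) => Ex.
    by right; exists a.
  rewrite /iet; case: pickP => [a /set_mem /letter_unit //|_ Ex]; by left.
move=> [[Ex nDx]|[a _ [Iax Ex]]]; last by rewrite (ietE Iax).
by rewrite /iet; case: pickP => // a /set_mem /letter_unit.
Qed.

(** Cut [E] along the images [J a] of the letter intervals: the preimage of each piece is a
    translate of it inside [I a], and translations preserve the volume. *)
Lemma vol_preimage_iet E : mble E -> vol [set x | E (T x)] = vol E.
Proof.
move=> mE; pose J a : set R := `[cumul lt2 I a - len a, cumul lt2 I a[%classic.
have mJ a : mble (J a) by exact: measurable_itv.
have IJ a x : I a x <-> J a (x + tau a).
  by rewrite /J /= in_itv; exact: iet_letterP.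
have [[_ tI _] _ _] := opI.
have JD a x : J a x -> unit_itv x.
  rewrite /J /= in_itv /= unit_itvE => /andP[? ?].
  have := cumul_ge lt2 a len_ge0; have := cumul_le lt2 a len_ge0.
  by rewrite sum_ilength; lra.
rewrite (vol_partition mble_letter tI letter_exists (mble_preimage_iet mE)).
rewrite (@vol_partition _ _ J _ mJ) //; first last.
- move=> y /iet_surj[x /letter_exists[a Iax] <-]; exists a.
  by rewrite (ietE Iax); apply/IJ.
- by apply: (tiling_trivIset slt2) => b c /(le_cumul slt2 len_ge0); lra.
apply: eq_bigr => a _; rewrite -(@vol_translate _ (E `&` J a) (tau a)).
- apply: eq_vol => x Dx; split => /= -[Ex Ix].
    by split; [rewrite -(ietE Ix)|apply/IJ].
  by have /IJ Iax := Ix; split=> //; rewrite (ietE Iax).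
- exact: measurableI.
- by move=> x [_ /JD].
- by move=> x [_ /IJ /letter_unit].
Qed.

Lemma mble_preimage_iter n E : mble E -> mble [set x | E (iter n T x)].
Proof.
elim: n E => //= n IHn E mE.
exact: (IHn [set x | E (T x)] (mble_preimage_iet mE)).
Qed.

Lemma vol_preimage_iter n E : mble E -> vol [set x | E (iter n T x)] = vol E.
Proof.
elim: n E => //= n IHn E mE; rewrite -[RHS]vol_preimage_iet //.
exact: (IHn [set x | E (T x)] (mble_preimage_iet mE)).
Qed.

Lemma iet_invK x : unit_itv x -> unit_itv (iet_inv lt1 lt2 I x) /\
  T (iet_inv lt1 lt2 I x) = x.
Proof.
move=> /iet_surj[y Dy <-]; rewrite /iet_inv pinvKV ?inE //.
by move=> u v; rewrite !inE; exact: iet_inj.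
Qed.

Lemma iter_iet_invK n x : unit_itv x ->
  unit_itv (iter n (iet_inv lt1 lt2 I) x) /\
  iter n T (iter n (iet_inv lt1 lt2 I) x) = x.
Proof.
move=> Dx; elim: n => //= n [Dn eqn]; have [Dn' eqn'] := iet_invK Dn.
by split => //; rewrite -iterS iterSr eqn'.
Qed.

Lemma iter_meet_orbits n x y : iter n T x = y ->
  iet_orbit lt1 lt2 I x `&` iet_orbit lt1 lt2 I y !=set0.
Proof. by move=> xy; exists y; split; [exists (Posz n)|exists (Posz 0)]. Qed.

(** Forward iterates clear the negative exponents of a common point, and injectivity of [T] cancels
    the steps shared by both sides. Two-sided orbits are thus reduced to forward iterates. *)
Lemma orbits_meet_iter x y : unit_itv x -> unit_itv y ->
  iet_orbit lt1 lt2 I x `&` iet_orbit lt1 lt2 I y !=set0 ->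
  exists n, iter n T x = y \/ iter n T y = x.
Proof.
move=> Dx Dy.
have shift z : unit_itv z -> forall m : int, exists i j : nat,
    unit_itv (iet_iter lt1 lt2 I m z) /\ iter i T (iet_iter lt1 lt2 I m z) = iter j T z.
  move=> Dz [j|j] /=; first by exists 0%N, j; split => //; exact: iter_iet_unit.
  by exists j.+1, 0%N; exact: (iter_iet_invK j.+1 Dz).
move=> [z [[m _ mz] [m' _ m'z]]].
have [i [j [Dz]]] := shift x Dx m; rewrite mz => ij.
have [i' [j' [_]]] := shift y Dy m'; rewrite m'z => ij'.
have eqxy : iter (i' + j) T x = iter (i + j') T y.
  by rewrite !iterD -ij -ij' -!iterD addnC.
have [le|/ltnW le] := leqP (i' + j) (i + j').
  exists (i + j' - (i' + j))%N; right; apply: (@iter_iet_inj (i' + j)) => //.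
    exact: iter_iet_unit.
  by rewrite -iterD subnKC.
exists (i' + j - (i + j'))%N; left; apply: (@iter_iet_inj (i + j')) => //.
  exact: iter_iet_unit.
by rewrite -iterD subnKC.
Qed.

Lemma periodic_finite_orbit n x : unit_itv x -> (0 < n)%N -> iter n T x = x ->
  finite_set (iet_orbit lt1 lt2 I x).
Proof.
move=> Dx n0 per.
have perM k : iter (k * n) T x = x by elim: k => // k IHk; rewrite mulSn iterD IHk.
suff orb m : exists k, iet_iter lt1 lt2 I m x = iter k T x.
  apply: (@sub_finite_set _ _ [set iter k T x | k in `I_n]).
    move=> _ [m _ <-]; have [k ->] := orb m; exists (k %% n)%N; first exact: ltn_pmod.
    by rewrite {2}(divn_eq k n) addnC iterD perM.
  exact/finite_image/finite_II.
case: m => [k|k]; first by exists k.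
have [Dk eqk] := iter_iet_invK k.+1 Dx.
(* Under a period [n], going back [k.+1] steps amounts to going forward this many; [0 < n] keeps the
   truncated subtraction exact. *)
exists (k.+1 * n - k.+1)%N; apply: (@iter_iet_inj k.+1) => //.
  exact: iter_iet_unit.
by rewrite -iterD subnKC ?leq_pmulr // perM.
Qed.

Lemma aperiodic_infinite_orbit x : unit_itv x ->
  (forall n, (0 < n)%N -> iter n T x <> x) ->
  infinite_set (iet_orbit lt1 lt2 I x).
Proof.
move=> Dx aper fin.
have inj : injective (fun n => iter n T x).
  have key i j : (i < j)%N -> iter i T x <> iter j T x.
    move=> ij eqij; apply: (aper (j - i)%N); first by rewrite subn_gt0.
    apply: (@iter_iet_inj i) => //; first exact: iter_iet_unit.
    by rewrite -iterD subnKC // ltnW.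
  by move=> i j eqij; case: (ltngtP i j) => // /key; rewrite eqij.
apply: infinite_nat; rewrite -[X in finite_set X](preimage_range (fun n => iter n T x)).
apply: finite_preimage; first by move=> i j _ _; exact: inj.
by apply: sub_finite_set fin => _ [n _ <-]; exists (Posz n).
Qed.
End IntervalExchangeMap.

(** * Word intervals *)

Lemma prefix_mismatch (A : eqType) (u v : seq A) :
  ~~ prefix u v -> ~~ prefix v u ->
  exists w a b z t, [/\ u = w ++ a :: z, v = w ++ b :: t & a != b].
Proof.
elim: u v => [|a u IHu] [|b v] //=; have [->|ab] := eqVneq a b => /=.
  move=> /IHu /[apply] -[w [c [d [z [t [-> -> cd]]]]]].
  by exists (b :: w), c, d, z, t.
by move=> _ _; exists [::], a, b, u, v.
Qed.

Lemma suffix_mismatch (A : eqType) (u v : seq A) :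
  ~~ suffix u v -> ~~ suffix v u ->
  exists w t z a b, [/\ u = w ++ a :: z, v = t ++ b :: z & a != b].
Proof.
rewrite /suffix => /prefix_mismatch /[apply] -[w [a [b [z [t [uE vE ab]]]]]].
exists (rev z), (rev t), (rev w), a, b; split => //.
  by rewrite -[u]revK uE rev_cat rev_cons cat_rcons.
by rewrite -[v]revK vE rev_cat rev_cons cat_rcons.
Qed.

Section WordIntervals.
Context {R : realType} {A : finType} (lt1 lt2 : rel A) (I : A -> set R)
  (hI : interval_exchange lt1 lt2 I).
Implicit Types (a b : A) (x y z : R) (u v w : seq A).

Local Notation T := (iet lt1 lt2 I).
Local Notation tau := (translation lt1 lt2 I).
Local Notation W := (word_interval lt1 lt2 I).

Definition word_translation w : R := \sum_(a <- w) tau a.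

Definition word_image w : set R := [set iter (size w) T x | x in W w].

Lemma word_interval_unit w x : W w x -> unit_itv x.
Proof. by case. Qed.

Lemma word_interval_nil x : W [::] x <-> unit_itv x.
Proof. by split=> [[]|Dx] //; split => // -[]. Qed.

Lemma word_interval_cons a w x : W (a :: w) x <-> I a x /\ W w (T x).
Proof.
split=> [[Dx Wx]|[Iax [DTx Wx]]].
  have Dx' : unit_itv x by [].
  split; first exact: (Wx 0%N).
  split; first exact: (iet_unit hI Dx').
  by move=> i b wi; rewrite -iterSr; exact: (Wx i.+1).
split; first exact: (letter_unit hI Iax).
by move=> [|i] b /= wi; [case: wi => <-|rewrite -[T _]/(iter i.+1 T x) iterSr; exact: Wx].
Qed.

Lemma word_interval_cat u v x :
  W (u ++ v) x <-> W u x /\ W v (iter (size u) T x).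
Proof.
elim: u x => [|a u IHu] x /=.
  split=> [Wx|[]//]; split => //; apply/word_interval_nil.
  exact: word_interval_unit Wx.
rewrite -[T _]/(iter (size u).+1 T x) iterSr.
split=> [/word_interval_cons[Ia /IHu[Wu Wv]]|[/word_interval_cons[Ia Wu] Wv]].
  by split=> //; apply/word_interval_cons.
by apply/word_interval_cons; split=> //; apply/IHu.
Qed.

Lemma iter_word_interval w x : W w x -> iter (size w) T x = x + word_translation w.
Proof.
rewrite /word_translation; elim: w x => [|a w IHw] x; first by rewrite big_nil addr0.
move=> /word_interval_cons[Ia Ww]; rewrite big_cons /= -iterS iterSr IHw //.
by rewrite (ietE hI Ia) [RHS]addrA.
Qed.

(** T^|w| is a single translation on I_w, so appending a letter [a] intersects I_w with a translate
    of [I a]. Hence the induction on the last letter; ends that cross merely encode the empty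
    set. *)
Lemma semi_interval_word w : semi_interval (W w).
Proof.
elim/last_ind: w => [|w a [al [be WE]]].
  exists 0, 1; apply/seteqP; split => x;
    by rewrite /= in_itv /= -unit_itvE => /word_interval_nil.
pose t := word_translation w.
exists (Order.max al (cumul lt1 I a - ilength I a - t)),
       (Order.min be (cumul lt1 I a - t)).
have Wal x : W w x <-> al <= x < be by rewrite WE /= in_itv.
apply/seteqP; split => x; rewrite /= in_itv /= ge_max lt_min.
  rewrite -cats1 => /word_interval_cat[Ww /word_interval_cons[Ia _]].
  move: Ia; rewrite (iter_word_interval Ww) (letter_itvE hI) -/t.
  by move/Wal: Ww => /andP[-> ->] /andP[? ?]; apply/andP; split; lra.
move=> /andP[/andP[? ?] /andP[? ?]]; rewrite -cats1; apply/word_interval_cat.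
have Ww : W w x by apply/Wal/andP.
split => //; apply/word_interval_cons; rewrite (iter_word_interval Ww).
have Ia : I a (x + t) by rewrite (letter_itvE hI); lra.
split => //; apply/word_interval_nil/(iet_unit hI)/(letter_unit hI Ia).
Qed.

Lemma mble_word_interval w : mble (W w).
Proof. by have [al [be ->]] := semi_interval_word w; exact: measurable_itv. Qed.

Lemma word_exists n x : unit_itv x -> exists2 w, size w = n & W w x.
Proof.
elim: n x => [|n IHn] x Dx; first by exists [::] => //; apply/word_interval_nil.
have [a Ia] := letter_exists hI Dx.
have [w <- Ww] := IHn _ (iet_unit hI Dx).
by exists (a :: w) => //; apply/word_interval_cons.
Qed.

Lemma word_interval_prefix u v x : W u x -> W v x ->
  (size u <= size v)%N -> prefix u v.
Proof.
elim: u v x => [v x _ _ _|a u IHu [|b v] x /word_interval_cons[Ia Wu] //].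
  exact: prefix0s.
move=> /word_interval_cons[Ib Wv] /= uv; rewrite (letter_unique hI Ia Ib) eqxx.
exact: IHu Wu Wv uv.
Qed.

(** The coding of a point of I_w starts with [w], and an occurrence of [w] at position n in the
    coding of [z] puts T^n z in I_w. *)
Lemma factor_setP w : factor_set lt1 lt2 I w <-> W w !=set0.
Proof.
split=> [[z [u [Dz uz [n ->]]]]|[x Wx]].
  exists (iter n T z); split; first exact: (@iter_iet_unit _ _ _ _ _ hI n z Dz).
  move=> i b; rewrite -iterD.
  case: (ltnP i (size w)) => wi; last by rewrite onth_default // size_mkseq.
  by move=> /(onth_nth b); rewrite nth_mkseq // addnC => /uz.
have Dx := word_interval_unit Wx.
have /choice[u uP] n : exists a, I a (iter n T x).
  by apply: (letter_exists hI); exact: (iter_iet_unit hI).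
exists x, u; split=> //; first by move=> n a; split=> [<- //|Ia];
  exact: (letter_unique hI (uP n) Ia).
exists 0%N; suff : mkseq u (size w) = w by [].
elim: w x Dx u uP Wx => //= a w IHw x Dx u uP /word_interval_cons[Ia Ww].
rewrite /mkseq /=; congr cons; first exact: (letter_unique hI (uP 0%N) Ia).
(* The sequence [u] shifted by one is the coding of [T x], to which the induction hypothesis
   applies. *)
rewrite -[X in iota X _]addn0 iotaDl -map_comp.
apply: (IHw (T x) (iet_unit hI Dx) (fun n => u n.+1) _ Ww) => n.
exact: (eq_ind _ (I (u n.+1)) (uP n.+1) _ (iterSr n T x)).
Qed.

Lemma word_imageP w y : word_image w y <-> W w (y - word_translation w).
Proof.
split=> [[x Ww <-]|Ww]; first by rewrite (iter_word_interval Ww) addrK.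
by exists (y - word_translation w) => //; rewrite (iter_word_interval Ww) subrK.
Qed.

Lemma word_image_unit w y : word_image w y -> unit_itv y.
Proof. by case=> x /word_interval_unit Dx <-; exact: (iter_iet_unit hI). Qed.

Lemma mble_word_image w : mble (word_image w).
Proof.
rewrite (_ : word_image w = [set y | W w (y + - word_translation w)]).
  by apply: mble_translate; exact: mble_word_interval.
by apply/seteqP; split=> y /word_imageP.
Qed.

(* The common tail of two words translates the tail parts of both points by
   the same amount, so the images compare as those of the last mismatch. *)
Lemma word_image_lt u v w a b x y : lt2 a b ->
  word_image (u ++ a :: w) x -> word_image (v ++ b :: w) y -> x < y.
Proof.
have tail s c z : word_image (s ++ c :: w) z ->
    exists2 p, I c p & z = T p + word_translation w.
  case=> p /word_interval_cat[_ /word_interval_cons[Ic Ww]] <-.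
  exists (iter (size s) T p) => //.
  by rewrite size_cat addnC iterD /= -iterS iterSr iter_word_interval.
move=> ab /tail[p Ia ->] /tail[q Ib ->]; rewrite ltrD2r.
exact: (iet_lt2 hI ab Ia Ib).
Qed.

(** The common prefix translates both points by the same amount, so they compare as the letter
    intervals reached after it. *)
Lemma word_interval_lt u v w a b x y : lt1 a b ->
  W (w ++ a :: u) x -> W (w ++ b :: v) y -> x < y.
Proof.
move=> ab /word_interval_cat[Wx /word_interval_cons[Ia _]].
move=> /word_interval_cat[Wy /word_interval_cons[Ib _]].
have [_ _ [_ _ oI]] := hI; have := oI _ _ ab _ _ Ia Ib.
by rewrite (iter_word_interval Wx) (iter_word_interval Wy) ltrD2r.
Qed.

(** By injectivity, the points of [0, 1[ that T^|w| sends into the image are exactly those of I_w,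
    and [T] preserves the volume. *)
Lemma vol_word_image w : vol (word_image w) = vol (W w).
Proof.
rewrite -(vol_preimage_iter hI (size w) (mble_word_image w)).
apply: eq_vol => x Dx; split=> [[z Wz]|Wx]; last by exists x.
by move=> /(iter_iet_inj hI (word_interval_unit Wz) Dx) <-.
Qed.

Lemma vol_word_imageI w E : mble E ->
  vol (E `&` word_image w) = vol ([set x | E (iter (size w) T x)] `&` W w).
Proof.
move=> mE; rewrite -(vol_preimage_iter hI (size w)).
  apply: eq_vol => x Dx; split=> [[Ex [z Wz]]|[Ex Wx]]; last first.
    by split => //; exists x.
  by move=> /(iter_iet_inj hI (word_interval_unit Wz) Dx) zx; split => //; rewrite -zx.
by apply: measurableI => //; exact: mble_word_image.
Qed.
End WordIntervals.

(** * Maximal bifix codes cover the unit interval *)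

Section BifixFamilies.
Context {R : realType} {A : finType} (lt1 lt2 : rel A) (I : A -> set R)
  (hI : interval_exchange lt1 lt2 I).
Context {B : finType} (u : B -> seq A)
  (K0 : forall b, word_interval lt1 lt2 I (u b) !=set0)
  (prefix_free : forall b c, b != c -> ~~ prefix (u b) (u c))
  (suffix_free : forall b c, b != c -> ~~ suffix (u b) (u c)).
Implicit Types (b c : B) (E : set R).

Local Notation T := (iet lt1 lt2 I).
Local Notation K b := (word_interval lt1 lt2 I (u b)).
Local Notation J b := (word_image lt1 lt2 I (u b)).

(** From a common point both words are read along one orbit, so the shorter would be a prefix of the
    longer. *)
Lemma trivIset_word_interval : trivIset setT (fun b => K b).
Proof.
move=> b c _ _ [x [Kb Kc]]; apply/eqP; apply: contraT => bc.
have [le|/ltnW le] := leqP (size (u b)) (size (u c)).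
  by have := prefix_free bc; rewrite (word_interval_prefix hI Kb Kc le).
rewrite eq_sym in bc.
by have := prefix_free bc; rewrite (word_interval_prefix hI Kc Kb le).
Qed.

(** Two words incomparable for [suffix] have a last mismatch, and the letters there separate the
    images through [lt2]. *)
Lemma trivIset_word_image : trivIset setT (fun b => J b).
Proof.
have [_ [_ _ tot] _] := hI.
move=> b c _ _ [x [Jb Jc]]; apply/eqP; apply: contraT => bc.
have cb : c != b by rewrite eq_sym.
have [s [t [z [a [d [ub uc]]]]]] := suffix_mismatch (suffix_free bc) (suffix_free cb).
rewrite ub in Jb; rewrite uc in Jc => /tot/orP[ad|da].
  by have := word_image_lt hI ad Jb Jc; rewrite ltxx.
by have := word_image_lt hI da Jc Jb; rewrite ltxx.
Qed.

Lemma vol_setI_bigcup (F : B -> set R) E : (forall b, mble (F b)) ->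
  trivIset setT F -> mble E ->
  vol (E `&` \bigcup_b F b) = \sum_b vol (E `&` F b).
Proof.
move=> mF tF mE; rewrite -[RHS](@vol_bigcup _ _ predT).
- apply: eq_vol => x _; split=> [[Ex [b _ Fb]]|[b _ [Ex Fb]]]; first by exists b.
  by split => //; exists b.
- by move=> b; apply: measurableI.
- by move=> b c _ _ [x [[_ Fb] [_ Fc]]]; apply: tF => //; exists x.
Qed.

Lemma word_intervals_cover : 1 <= \sum_b vol (K b) ->
  forall z, unit_itv z -> exists b, K b z.
Proof.
move=> sum1 z Dz.
have /choice[p pP] : forall b, exists p : R * R,
    [/\ K b = `[p.1, p.2[%classic, 0 <= p.1, p.1 < p.2 & p.2 <= 1].
  move=> b; apply: semi_interval_ends => //; first exact: (semi_interval_word hI).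
  by move=> x /word_interval_unit.
have [||| b] := @tiling_cover _ _ (fun b => (p b).1) (fun b => (p b).2) _ _ _ z Dz.
- by move=> b; have [_ ? /ltW ? ?] := pP b; split.
- have <- : (fun b => K b) = (fun b => `[(p b).1, (p b).2[%classic).
    by apply/funext => b; case: (pP b).
  exact: trivIset_word_interval.
- apply: (le_trans sum1); apply: ler_sum => b _.
  by have [-> ? /ltW ? ?] := pP b; rewrite vol_itv.
- by move=> zb; exists b; have [-> _ _ _] := pP b; rewrite /= in_itv.
Qed.

(** The part of [G] outside [F] is null, and cutting by [E] keeps it null. *)
Lemma eq_vol_setI_sub (E F G : set R) : mble E -> mble F -> mble G ->
  (forall x, unit_itv x -> F x -> G x) -> vol F = vol G -> vol (E `&` F) = vol (E `&` G).
Proof.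
move=> mE mF mG FG eqv; have mEG : mble (E `&` G) by exact: measurableI.
have mEF : mble (E `&` F) by exact: measurableI.
rewrite (volID mEG mF).
have -> : vol (E `&` G `&` F) = vol (E `&` F).
  by apply: eq_vol => x Dx; split=> [[[]]|[Ex Fx]] //; split=> //; split=> //; apply: FG.
suff : vol (E `&` G `\` F) <= 0.
  by have := vol_ge0 (E `&` G `\` F); lra.
have := volID mG mF.
have -> : vol (G `&` F) = vol F.
  by apply: eq_vol => x Dx; split=> [[]|Fx] //; split=> //; apply: FG.
rewrite eqv => eqG.
have <- : vol (G `\` F) = 0 by lra.
apply: le_vol; [exact: measurableD|exact: measurableD|].
by move=> x _ [[_ Gx] nFx]; split.
Qed.

(* If every long orbit segment leaving the complement of the K b ended in the
   union of the J b, the set W of points hitting the complement V of that union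
   after time L would satisfy W = T^-m W up to a null set, and comparing the
   pieces of W in the K b and in the J b would give vol V = 0. *)
Lemma uncovered_connection L : (exists2 z, unit_itv z & forall b, ~ K b z) ->
  exists n z, [/\ (L <= n)%N, unit_itv z, forall b, ~ K b z
    & forall b, ~ J b (iter n T z)].
Proof.
move=> [z0 Dz0 nK0]; apply: contrapT => none.
have mK b : mble (K b) by exact: (mble_word_interval hI).
have mJ b : mble (J b) by exact: (mble_word_image hI).
have mUJ : mble (\bigcup_b J b) by apply: fin_bigcup_measurable.
pose V := unit_itv `\` \bigcup_b J b.
have mV : mble V by apply: measurableD => //; exact: mble_unit_itv.
pose W : set R := \bigcup_n [set x | V (iter (n + L) T x)].
have mW : mble W.
  by apply: bigcup_measurable => n _; exact: (mble_preimage_iter hI).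
pose P m := [set x | W (iter m T x)].
have mP m : mble (P m) by exact: (mble_preimage_iter hI).
have PW E m : mble E -> vol (E `&` P m) = vol (E `&` W).
  move=> mE; apply: eq_vol_setI_sub => //; last exact: (vol_preimage_iter hI).
  by move=> x Dx [n _ /=]; rewrite -iterD => Vn; exists (n + m)%N => //=;
    rewrite addnAC.
(* Poincare recurrence: T^-L V lies in [W], so pulling back by T^L shows that almost all of [V] lies
   in [W]. *)
have volV : vol (V `&` W) = vol V.
  rewrite -(vol_preimage_iter hI L); last exact: measurableI.
  rewrite -[RHS](vol_preimage_iter hI L) //.
  have mVL : mble [set x | V (iter L T x)] by exact: (mble_preimage_iter hI).
  rewrite (PW [set x | V (iter L T x)] L mVL).
  by apply: eq_vol => x Dx; split=> [[]|Vx] //; split => //; exists 0%N.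
have volK : \sum_b vol (W `&` K b) = vol W.
  rewrite -vol_setI_bigcup //; last exact: trivIset_word_interval.
  apply: eq_vol => x Dx; split=> [[]|Wx] //; split => //; apply: contrapT => nKx.
  case: Wx => n _ /= [_ nJ]; apply: none; exists (n + L)%N, x; split=> //.
  - exact: leq_addl.
  - by move=> b Kb; apply: nKx; exists b.
  - by move=> b Jb; apply: nJ; exists b.
have volJ : vol (W `&` \bigcup_b J b) = vol W.
  rewrite vol_setI_bigcup //; last exact: trivIset_word_image.
  rewrite -volK; apply: eq_bigr => b _.
  by rewrite (vol_word_imageI hI) // setIC PW // setIC.
have volV0 : vol V = 0.
  have := volID mW mUJ; rewrite volJ -volV.
  rewrite (@eq_vol _ (V `&` W) (W `\` \bigcup_b J b)); first by lra.
  by move=> x Dx; split=> [[[_ nJ] Wx]|[Wx nJ]].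
have [|b Kb] := word_intervals_cover _ Dz0; last exact: nK0 Kb.
(* With [V] null the [J b] have total volume 1, hence so do the [K b], which would then cover
   [z0]. *)
have sumJ : \sum_b vol (J b) = vol (\bigcup_b J b).
  rewrite -[X in vol X]setTI vol_setI_bigcup //; last exact: trivIset_word_image.
  by apply: eq_bigr => b _; rewrite setTI.
under eq_bigr do rewrite -(vol_word_image hI).
have := volID (@measurableT _ (measurableTypeR R)) mUJ.
rewrite vol_setT setTI sumJ (@eq_vol _ (setT `\` _) V); first by rewrite volV0; lra.
by move=> x Dx; split=> [[_ nJ]|[_ nJ]].
Qed.

Lemma maximal_bifix_cover :
  (forall w, word_interval lt1 lt2 I w !=set0 -> w <> [::] -> exists b,
    [|| prefix (u b) w, prefix w (u b), suffix (u b) w | suffix w (u b)]) ->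
  forall z, unit_itv z -> exists b, K b z.
Proof.
move=> umax z Dz; apply: contrapT => nK.
(* A word of length at least [L] is too long to be a prefix or suffix of any [u b]. Starting outside
   every [K b] and ending outside every [J b] rule out the two converse comparisons. *)
pose L := (\max_b size (u b)).+1.
have ltL b : (size (u b) < L)%N by rewrite ltnS; exact: leq_bigmax.
have [|n [x [Ln Dx nKx nJx]]] := @uncovered_connection L.
  by exists z => // b Kb; apply: nK; exists b.
have [w wn Ww] := word_exists hI n Dx.
have [||b] := umax w; first by exists x.
  by move=> w0; move: Ln; rewrite -wn w0.
case/or4P => [/prefixP[v wE]|/size_prefix le|/suffixP[v wE]|/size_suffix le].
- by apply: (nKx b); move: Ww; rewrite wE => /(word_interval_cat hI)[].
- by have := ltL b; rewrite ltnNge (leq_trans Ln) // -wn.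
- apply: (nJx b); move: Ww; rewrite wE => /(word_interval_cat hI)[_ Kv].
  by exists (iter (size v) T x) => //; rewrite -iterD -wn wE size_cat addnC.
- by have := ltL b; rewrite ltnNge (leq_trans Ln) // -wn.
Qed.
End BifixFamilies.

(** * Separation points and regularity *)

Section SeparationPoints.
Context {R : realType} {A : finType} (lt1 lt2 : rel A) (I : A -> set R)
  (hI : interval_exchange lt1 lt2 I).
Implicit Types (a b : A) (x y z : R).

Local Notation T := (iet lt1 lt2 I).
Local Notation mu := (cumul lt1 I).

Let slt1 : strict_total_order lt1. Proof. by case: hI. Qed.

Let len_ge0 a : 0 <= ilength I a. Proof. exact: ltW (ilength_gt0 hI a). Qed.

Lemma cumul_gt0 a : 0 < mu a.
Proof. exact: lt_le_trans (ilength_gt0 hI a) (cumul_ge lt1 a len_ge0). Qed.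

Lemma not_greatest_cumul_unit a : not_greatest lt1 a -> unit_itv (mu a).
Proof.
move=> [b ab]; rewrite unit_itvE ltW ?cumul_gt0 //=.
have := le_cumul slt1 len_ge0 ab; have := cumul_le lt1 b len_ge0.
by rewrite (sum_ilength hI); have := ilength_gt0 hI b; lra.
Qed.

(** The left end sums the lengths of the letters below [a], which is [mu] of the predecessor of [a],
    found as the lower letter with the largest [mu]. Positivity ensures that a lower letter
    exists. *)
Lemma left_end_cumul a : 0 < mu a - ilength I a ->
  exists2 b, lt1 b a & mu b = mu a - ilength I a.
Proof.
have [irr tr tot] := slt1.
have -> : mu a - ilength I a = \sum_(c | lt1 c a) ilength I c.
  rewrite /cumul (bigD1 a) ?eqxx //= addrAC subrr add0r; apply: eq_bigl => c.
  by case: eqVneq => [->|]; rewrite /= ?irr ?andbT ?andbF.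
case: (pickP [pred c | lt1 c a]) => [c0 /= c0a _|none]; last first.
  by rewrite big_pred0 ?ltxx // => c; exact: none.
case: (@Order.TotalTheory.arg_maxP _ _ _ c0 [pred c | lt1 c a] mu) => //= b ba bmax.
exists b => //; apply: eq_bigl => c; apply/idP/idP.
  by case/orP => [/eqP ->//|cb]; exact: tr cb ba.
move=> ca; case: (eqVneq c b) => //= /tot/orP[//|bc].
have := bmax _ ca; have := le_cumul slt1 len_ge0 bc; have := ilength_gt0 hI c.
by rewrite /Order.ge /=; lra.
Qed.

(** Induction along [w]: if [x] is the left end of its letter interval, it is a separation point;
    otherwise there is room on its left and a neighbourhood is pulled back from [T x]. The condition
    [0 < x] excludes the left end 0, which is no separation point. *)
Lemma word_interval_left w x : word_interval lt1 lt2 I w x -> 0 < x ->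
  (exists k a, [/\ (k < size w)%N, not_greatest lt1 a & iter k T x = mu a]) \/
  (exists2 e, 0 < e & forall y, x - e <= y <= x -> word_interval lt1 lt2 I w y).
Proof.
elim: w x => [|a w IHw] x.
  move=> /word_interval_nil; rewrite unit_itvE => /andP[x0 x1] xgt0; right.
  by exists x => // y yx; apply/word_interval_nil; rewrite unit_itvE; lra.
move=> /(word_interval_cons hI)[Iax Wx] x0.
have /andP[ax xa] : mu a - ilength I a <= x < mu a by rewrite -(letter_itvE hI).
have [left|nleft] := eqVneq x (mu a - ilength I a).
  left; rewrite left in x0; have [b ba bE] := left_end_cumul x0.
  by exists 0%N, b; split => //=; [exists a|rewrite left].
have ltax : mu a - ilength I a < x by rewrite lt_neqAle eq_sym nleft.
have Il : I a (mu a - ilength I a).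
  by rewrite (letter_itvE hI); have := ilength_gt0 hI a; lra.
(* [T x] lies strictly to the right of the image of the left end of [I a], which is itself at least
   0. *)
have Tx0 : 0 < T x.
  have := iet_unit hI (letter_unit hI Il); rewrite unit_itvE.
  by rewrite (ietE hI Il) (ietE hI Iax) => /andP[? _]; lra.
case: (IHw _ Wx Tx0) => [[k [b [kw nb kE]]]|[e e0 eP]].
  by left; exists k.+1, b; split; rewrite // iterSr.
right; exists (Order.min e (x - (mu a - ilength I a))).
  by rewrite lt_min e0 subr_gt0.
move=> y /andP[ey yx].
have [ye ya] : x - e <= y /\ mu a - ilength I a <= y.
  have : Order.min e (x - (mu a - ilength I a)) <= e by rewrite ge_min lexx.
  have : Order.min e (x - (mu a - ilength I a)) <= x - (mu a - ilength I a).
    by rewrite ge_min lexx orbT.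
  by move=> *; split; lra.
have Iay : I a y by rewrite (letter_itvE hI); lra.
apply/(word_interval_cons hI); split => //; apply: eP.
by rewrite (ietE hI Iay) (ietE hI Iax); lra.
Qed.
End SeparationPoints.

(** Irreflexivity and transitivity are transferred from the order of [R] through points of the
    blocks, which avoids a combinatorial study of the word orders. *)
Lemma strict_total_order_separated (R : realType) (B : eqType) (lt : rel B)
    (F : B -> set R) :
  (forall b, F b !=set0) ->
  (forall b c, lt b c -> forall x y, F b x -> F c y -> x < y) ->
  (forall b c, b != c -> lt b c || lt c b) ->
  strict_total_order lt.
Proof.
move=> F0 sep tot.
have irr : irreflexive lt.
  move=> b; apply/negP => bb; have [x Fx] := F0 b.
  by have := sep _ _ bb _ _ Fx Fx; rewrite ltxx.
have tr : transitive lt.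
  move=> c b d bc cd; have [x Fx] := F0 b; have [y Fy] := F0 c; have [z Fz] := F0 d.
  have xz := lt_trans (sep _ _ bc _ _ Fx Fy) (sep _ _ cd _ _ Fy Fz).
  have [bd|/tot/orP[//|db]] := eqVneq b d.
    by subst d; have := sep _ _ bc _ _ Fx Fy; have := sep _ _ cd _ _ Fy Fx; lra.
  by have := sep _ _ db _ _ Fz Fx; lra.
by split.
Qed.

(** * The coded exchange and its separation points *)

Section CodedExchange.
Context {R : realType} {A : finType} (lt1 lt2 : rel A) (I : A -> set R)
  (hI : interval_exchange lt1 lt2 I).
Context {B : finType} (u : B -> seq A)
  (K0 : forall b, word_interval lt1 lt2 I (u b) !=set0)
  (prefix_free : forall b c, b != c -> ~~ prefix (u b) (u c))
  (suffix_free : forall b c, b != c -> ~~ suffix (u b) (u c))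
  (Kcover : forall z, unit_itv z -> exists b, word_interval lt1 lt2 I (u b) z).
Implicit Types (b c d : B) (x y z : R).

Local Notation T := (iet lt1 lt2 I).
Local Notation K := (fun b => word_interval lt1 lt2 I (u b)).
Local Notation J := (fun b => word_image lt1 lt2 I (u b)).
Local Notation ltB1 := (fun b c => word_lt1 lt1 (u b) (u c)).
Local Notation ltB2 := (fun b c => word_lt2 lt2 (u b) (u c)).
Local Notation Tf := (iet ltB1 ltB2 K).
Local Notation delta := (cumul ltB1 K).

Lemma word_lt1_separated b c : ltB1 b c -> forall x y, K b x -> K c y -> x < y.
Proof.
move=> /asboolP[[pbc bc]|[w [z [t [a [d [ub uc ad]]]]]]] x y.
  have : b != c by apply: contraNneq bc => ->.
  by move/prefix_free; rewrite pbc.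
by rewrite ub uc; exact: (word_interval_lt hI ad).
Qed.

Lemma word_lt2_separated b c : ltB2 b c -> forall x y, J b x -> J c y -> x < y.
Proof.
move=> /asboolP[[sbc bc]|[w [z [t [a [d [ub uc ad]]]]]]] x y.
  have : b != c by apply: contraNneq bc => ->.
  by move/suffix_free; rewrite sbc.
by rewrite ub uc; exact: (word_image_lt hI ad).
Qed.

Lemma word_lt1_total b c : b != c -> ltB1 b c || ltB1 c b.
Proof.
move=> bc; have [[_ _ tot] _ _] := hI.
have cb : c != b by rewrite eq_sym.
have [w [a [d [z [t [ub uc /tot/orP[ad|ad]]]]]]] :=
  prefix_mismatch (prefix_free bc) (prefix_free cb); apply/orP; [left|right];
  by apply/asboolP; right; exists w; do 4!eexists; split; [eassumption..|].
Qed.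

Lemma word_lt2_total b c : b != c -> ltB2 b c || ltB2 c b.
Proof.
move=> bc; have [_ [_ _ tot] _] := hI.
have cb : c != b by rewrite eq_sym.
have [w [t [z [a [d [ub uc /tot/orP[ad|ad]]]]]]] :=
  suffix_mismatch (suffix_free bc) (suffix_free cb); apply/orP; [left|right].
  by apply/asboolP; right; exists w, z, t, a, d.
by apply/asboolP; right; exists t, z, w, d, a.
Qed.

Lemma coded_interval_exchange : interval_exchange ltB1 ltB2 K.
Proof.
split.
- exact: strict_total_order_separated K0 word_lt1_separated word_lt1_total.
- apply: (strict_total_order_separated _ word_lt2_separated word_lt2_total).
  by move=> b; have [x Kx] := K0 b; exists (iter (size (u b)) T x), x.
- split; [split|by move=> b; exact: (semi_interval_word hI)|exact: word_lt1_separated].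
  + apply/seteqP; split => [x [b _ /word_interval_unit //]|x /Kcover[b Kb]].
    by exists b.
  + exact: (trivIset_word_interval hI prefix_free).
  + by move=> b _; exact: K0.
Qed.

Let hIf := coded_interval_exchange.

(** The images [J c] have the lengths of the [K c], of total 1, and are ordered by [ltB2]. Hence
    [cumul ltB2 K b] is the right end of [J b], that is, the right end of [K b] moved by the word
    translation. *)
Lemma coded_translation b :
  translation ltB1 ltB2 K b = word_translation lt1 lt2 I (u b).
Proof.
pose t c := word_translation lt1 lt2 I (u c).
pose be c := delta c + t c; pose al c := be c - ilength K c.
have lt_ab c : al c < be c by rewrite /al; have := ilength_gt0 hIf c; lra.
have JE c x : J c x <-> al c <= x < be c.
  have eqv : (delta c - ilength K c <= x - t c < delta c) = (al c <= x < be c).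
    by rewrite /al /be lerBrDr ltrBlDr addrAC.
  rewrite -eqv -(letter_itvE hIf); exact: (word_imageP hI).
have ab c : [/\ 0 <= al c, al c < be c & be c <= 1].
  have [|? ?] := itv_sub_unit (lt_ab c); last by split.
  by move=> x /JE/(word_image_unit hI).
have ltP c d : ltB2 c d -> be c <= al d.
  move=> cd; apply: (itv_separated (lt_ab c) (lt_ab d)) => x y /JE Jx /JE Jy.
  exact: word_lt2_separated cd _ _ Jx Jy.
have lenE c : be c - al c = ilength K c by rewrite /al; lra.
have slt2 : strict_total_order ltB2 by case: hIf.
rewrite /translation -/(t b).
have -> : cumul ltB2 K b = be b.
  rewrite -(tiling_right_end slt2 ab ltP); first by apply: eq_bigr.
  by rewrite -(sum_ilength hIf); apply: eq_bigr.
by rewrite /be; lra.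
Qed.

Lemma coded_ietE b x : K b x -> Tf x = iter (size (u b)) T x.
Proof.
by move=> Kb; rewrite (ietE hIf Kb) coded_translation (iter_word_interval hI).
Qed.

Lemma iter_coded_iet n x : unit_itv x -> exists N, iter n Tf x = iter N T x.
Proof.
elim: n x => [|n IHn] x Dx; first by exists 0%N.
have [b Kb] := Kcover Dx; rewrite iterSr (coded_ietE Kb).
have [N ->] := IHn _ (iter_iet_unit hI (size (u b)) Dx).
by exists (N + size (u b))%N; rewrite iterD.
Qed.

Lemma iterS_coded_iet n b x : K b x ->
  exists2 N, (size (u b) <= N)%N & iter n.+1 Tf x = iter N T x.
Proof.
move=> Kb; rewrite iterSr (coded_ietE Kb).
have Dx := word_interval_unit Kb.
have [N ->] := iter_coded_iet n (iter_iet_unit hI (size (u b)) Dx).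
by exists (N + size (u b))%N; [exact: leq_addl|rewrite iterD].
Qed.

(** Otherwise points just left of [delta b] would lie in the same [K c] as [delta b]. Those points
    belong to [K b], whereas [delta b], its excluded right end, does not. *)
Lemma coded_separation_point b : not_greatest ltB1 b ->
  exists c k a, [/\ K c (delta b), (k < size (u c))%N, not_greatest lt1 a
    & iter k T (delta b) = cumul lt1 I a].
Proof.
move=> ngb; have [c Kc] := Kcover (not_greatest_cumul_unit hIf ngb).
case: (word_interval_left hI Kc (cumul_gt0 hIf b)) => [[k [a [? ? ?]]]|[e e0 eP]].
  by exists c, k, a.
have lb0 := ilength_gt0 hIf b.
(* The maximum keeps [y] both within [e] of [delta b] and inside [K b]. *)
pose y := Order.max (delta b - e) (delta b - ilength K b).
have ylt : y < delta b by rewrite /y gt_max; lra.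
have Kcy : K c y by apply: eP; rewrite (ltW ylt) andbT /y le_max lexx.
have Kby : K b y by rewrite (letter_itvE hIf) ylt andbT /y le_max lexx orbT.
move: Kc; rewrite -(letter_unique hIf Kby Kcy) (letter_itvE hIf).
by rewrite ltxx andbF.
Qed.

Context (hT : regular_interval_exchange lt1 lt2 I).

Lemma coded_no_connection n b c : not_greatest ltB1 b -> not_greatest ltB1 c ->
  iter n.+1 Tf (delta b) <> delta c.
Proof.
move=> /coded_separation_point[b' [k [a [Kb' kb' nga kE]]]].
move=> /coded_separation_point[c' [k' [a' [_ _ nga' kE']]]].
have [N leN ->] := iterS_coded_iet n Kb' => NE.
have kN : (k < N)%N := leq_trans kb' leN.
(* From T^k (delta b) = mu_a, a further N - k > 0 steps reach [delta c], and k' more reach mu_a'.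
   Disjointness of orbits forces a = a', so mu_a is periodic, against its infinite orbit. *)
have connect : iter (k' + (N - k)) T (cumul lt1 I a) = cumul lt1 I a'.
  by rewrite -kE -iterD -addnA subnK ?(ltnW kN) // iterD NE kE'.
have [_ infT disjT] := hT.
have aa' : a = a' by apply: disjT => //; exact: iter_meet_orbits connect.
subst a'; apply: (infT a nga); apply: (periodic_finite_orbit hI _ _ connect).
  exact: not_greatest_cumul_unit hI _ nga.
by rewrite addn_gt0 subn_gt0 kN orbT.
Qed.

(** Aperiodicity is the case b = c of [coded_no_connection]. Two orbits that meet give a connection
    one way or the other; with zero steps the separation points coincide and [cumul_inj] identifies
    the letters. *)
Lemma coded_regular : regular_interval_exchange ltB1 ltB2 K.
Proof.
split=> // [b ngb|b c ngb ngc].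
  apply: (aperiodic_infinite_orbit hIf (not_greatest_cumul_unit hIf ngb)).
  by case=> // n _; exact: coded_no_connection.
move=> /(orbits_meet_iter hIf (not_greatest_cumul_unit hIf ngb)
  (not_greatest_cumul_unit hIf ngc))[[|n] []].
- by have [slt _ _] := hIf; apply: (cumul_inj slt); exact: ilength_gt0 hIf.
- by have [slt _ _] := hIf; move/esym; apply: (cumul_inj slt); exact: ilength_gt0 hIf.
- by move/coded_no_connection => /(_ ngb ngc).
- by move/coded_no_connection => /(_ ngc ngb).
Qed.
End CodedExchange.

Theorem theorem3p12 (R : realType) (A : finType) (lt1 lt2 : rel A)
    (I : A -> set R) (hT : regular_interval_exchange lt1 lt2 I)
    (X : set (seq A)) (hfin : finite_set X)
    (hX : maximal_bifix_code (factor_set lt1 lt2 I) X)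
    (B : finType) (f : seq B -> seq A) (hf : coding_morphism X f) :
  regular_interval_exchange
    (coded_lt (word_lt1 lt1) f) (coded_lt (word_lt2 lt2) f)
    (coded_family lt1 lt2 I f).
Proof.
have [hI _ _] := hT; have [_ _ [funf injf surjf]] := hf.
have [[X0 Xpre Xsuf] XS Xmax] := hX.
pose u b := f [:: b].
have uX b : X (u b) by exact: funf.
have uneq b c : b != c -> u b != u c.
  by apply: contraNneq => ubc; apply/eqP/injf; rewrite ?inE.
have pf b c : b != c -> ~~ prefix (u b) (u c).
  by move=> /uneq bc; apply/negP => pbc; apply: (Xpre (u b) (u c)).
have sf b c : b != c -> ~~ suffix (u b) (u c).
  by move=> /uneq bc; apply/negP => sbc; apply: (Xsuf (u b) (u c)).
have K0 b : word_interval lt1 lt2 I (u b) !=set0.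
  by apply/(factor_setP hI)/XS.
apply: (coded_regular hI K0 pf sf _ hT).
apply: (maximal_bifix_cover hI K0 pf sf) => w Ww w0; apply: contrapT => nw.
have new x : X x -> [/\ ~~ prefix x w, ~~ prefix w x, ~~ suffix x w & ~~ suffix w x].
  move=> /surjf[b _ <-]; apply/and4P; rewrite -!negb_or; apply/negP => bw.
  by apply: nw; exists b.
(* A nonempty factor incomparable with all words of [X] would extend it to a larger bifix code
   inside F(T), against maximality. *)
apply: (Xmax (X `|` [set w])).
- split.
  + by move=> x [/X0|->].
  + move=> x y [Xx|->] [Xy|->] [xy neq].
    * exact: (Xpre x y).
    * by have [] := new x Xx; rewrite xy.
    * by have [] := new y Xy; rewrite xy.
    * by rewrite eqxx in neq.
  + move=> x y [Xx|->] [Xy|->] [xy neq].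
    * exact: (Xsuf x y).
    * by have [] := new x Xx; rewrite xy.
    * by have [] := new y Xy; rewrite xy.
    * by rewrite eqxx in neq.
- by move=> x [/XS //|->]; apply/(factor_setP hI).
- split; first by left.
  by move=> /(_ w (or_intror erefl)) /new[]; rewrite prefix_refl.
Qed.
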